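(* Let $X$ be a partial groupoid. The following are equivalent: (1) $X$ embeds in a groupoid (that is, there is a monomorphism of symmetric sets $X\to NG$ for some groupoid $G$). (2) $X$ embeds in its fundamental groupoid via the unit map $X\to N\tau X$. (3) All one-simplices of $X$ are happy. (4) All words of $X$ are kind.
   Context: Let $\Upsilon$ be the category whose objects are the sets $[n]=\{0,1,\dots,n\}$, $n\ge 0$, with arbitrary functions as morphisms. A symmetric set is a functor $X\colon \Upsilon^{\mathrm{op}}\to \mathsf{Set}$, with $X_n=X([n])$; it has an underlying simplicial set by restriction along $\Delta\to\Upsilon$. Morphisms of symmetric sets are natural transformations. For $n\ge 1$, $\mathbf{W}(X)_n$ is the set of compatible words $(f_1,\dots,f_n)$ of elements of $X_1$: $x_0\xrightarrow{f_1}x_1\xrightarrow{f_2}\cdots\xrightarrow{f_n}x_n$. Put $\mathbf{W}^+(X)=\coprod_{n\ge1}\mathbf{W}(X)_n$. The Segal map $X_n\to\mathbf{W}(X)_n$ sends a simplex to its principal edges. $X$ is spiny if the Segal map is injective for all $n\ge1$. A partial groupoid is a spiny symmetric set. If $(f_1,\dots,f_n)$ is in the image of the Segal map, the corresponding simplex is written $[f_1|\cdots|f_n]$. Each groupoid $G$ is regarded as a partial groupoid via the fully faithful nerve functor $N\colon\mathsf{Gpd}\to\mathsf{Sym}$, where $(NG)_n$ is the set of functors to $G$ from the groupoid with object set $[n]$ and exactly one morphism between any two objects. The left adjoint of $N$ is $\tau$; $\tau X$ is called the fundamental groupoid of $X$. Explicitly its objects are $X_0$ and its morphisms are the words in $\mathbf{W}^+(X)$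 modulo the equivalence relation generated by replacing consecutive letters $f_i,f_{i+1}$ with $d_1[f_i|f_{i+1}]$ whenever $[f_i|f_{i+1}]\in X_2$. For $0<i<n$ there is a partially defined inner face map $d_i\colon\mathbf{W}(X)_n\nrightarrow\mathbf{W}(X)_{n-1}$, defined on $(f_1,\dots,f_n)$ exactly when $[f_i|f_{i+1}]\in X_2$, with value $(f_1,\dots,f_{i-1},d_1[f_i|f_{i+1}],f_{i+2},\dots,f_n)$. A word $w\in\mathbf{W}(X)_n$ is mean if there are sequences $i_1,\dots,i_{n-1}$ and $j_1,\dots,j_{n-1}$ with $0<i_k,j_k<k+1$ such that $d_{i_1}\cdots d_{i_{n-1}}(w)$ and $d_{j_1}\cdots d_{j_{n-1}}(w)$ are both defined and are different; otherwise $w$ is kind. A one-simplex is sad if it arises as such an iterated inner face $d_{i_1}\cdots d_{i_{n-1}}(w)\in X_1$ of some mean word $w$; all other one-simplices are happy. *)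

(* Defs.v *)
From Stdlib Require Import Relation_Operators.
From mathcomp Require Import all_boot generic_quotient boolp.

Set Implicit Arguments.
Unset Strict Implicit.
Unset Printing Implicit Defensive.

(* The object [n] = {0, ..., n} of Upsilon is 'I_n.+1, and its morphisms are
   plain functions; a symmetric set is a functor Upsilon^op -> Type. *)
Record symset := SymSet {
  simplex :> nat -> Type;
  act : forall m n, ('I_m.+1 -> 'I_n.+1) -> simplex n -> simplex m;
  act_id : forall n (x : simplex n), act id x = x;
  act_comp : forall l m n (a : 'I_l.+1 -> 'I_m.+1) (b : 'I_m.+1 -> 'I_n.+1)
    (x : simplex n), act (b \o a) x = act a (act b x) }.

Arguments act {s m n} a x.

Record symmap (X Y : symset) := SymMap {
  mapn :> forall n, X n -> Y n;
  map_act : forall m n (a : 'I_m.+1 -> 'I_n.+1) (x : X n),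
    mapn (act a x) = act a (mapn x) }.

Arguments mapn {X Y} s {n} x.

Program Definition comp_symmap (X Y Z : symset) (g : symmap Y Z)
    (f : symmap X Y) : symmap X Z :=
  {| mapn := fun n x => g n (f n x) |}.
Next Obligation. by rewrite !map_act. Qed.

Definition is_mono (X Y : symset) (f : symmap X Y) : Prop :=
  forall (Z : symset) (g h : symmap Z X),
    comp_symmap f g = comp_symmap f h -> g = h.

Definition vertex (X : symset) n (i : 'I_n.+1) (x : X n) : X 0 :=
  act (fun _ : 'I_1 => i) x.

Definition edge (X : symset) n (i j : 'I_n.+1) (x : X n) : X 1 :=
  act (fun k : 'I_2 => if k == ord0 then i else j) x.

Definition source (X : symset) (f : X 1) : X 0 := vertex ord0 f.
Definition target (X : symset) (f : X 1) : X 0 := vertex ord_max f.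

Definition degen (X : symset) (x : X 0) : X 1 := act (fun _ : 'I_2 => ord0) x.

(* The face d_1 : X_2 -> X_1, which omits the vertex 1. *)
Definition d1 (X : symset) (s : X 2) : X 1 := edge ord0 ord_max s.

Section Simplices.
Variable X : symset.

Lemma vertex_act m n (a : 'I_m.+1 -> 'I_n.+1) i (x : X n) :
  vertex i (act a x) = vertex (a i) x.
Proof. by rewrite /vertex -act_comp. Qed.

Lemma edge_act m n (a : 'I_m.+1 -> 'I_n.+1) i j (x : X n) :
  edge i j (act a x) = edge (a i) (a j) x.
Proof.
rewrite /edge -act_comp; congr (act _ x).
by apply: funext => k /=; case: ifP.
Qed.

Lemma source_edge n i j (x : X n) : source (edge i j x) = vertex i x.
Proof. by rewrite /source /edge vertex_act. Qed.

Lemma target_edge n i j (x : X n) : target (edge i j x) = vertex j x.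
Proof. by rewrite /target /edge vertex_act. Qed.

Lemma edge_diag n i (x : X n) : edge i i x = degen (vertex i x).
Proof.
rewrite /edge /degen /vertex -act_comp; congr (act _ x).
by apply: funext => k /=; case: ifP.
Qed.

Lemma edge01 (f : X 1) : edge ord0 ord_max f = f.
Proof.
rewrite -[RHS]act_id; congr (act _ f); apply: funext => k.
by case: eqP => [->//|/eqP k0]; apply/val_inj; case: k k0 => [[|[|]]].
Qed.

End Simplices.

(* [is_path x w y] says that w is a compatible sequence of one-simplices
   x -> ... -> y; the empty sequence is a path from x to itself. *)
Fixpoint is_path (X : symset) (x : X 0) (w : seq (X 1)) (y : X 0) : Prop :=
  if w is f :: w' then source f = x /\ is_path (target f) w' y else x = y.

(* W(X)_n; only the case n >= 1 is used. *)
Record word (X : symset) (n : nat) := Word {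
  letters :> n.-tuple (X 1);
  letters_path : exists x y, is_path x letters y }.

Definition principal_edges (X : symset) n (x : X n) : n.-tuple (X 1) :=
  [tuple edge (inord i) (inord i.+1) x | i < n].

Lemma principal_edges_path (X : symset) n (x : X n) :
  exists a b, is_path a (principal_edges x) b.
Proof.
exists (vertex (inord 0) x), (vertex (inord n) x).
have -> : principal_edges x =
    [seq edge (inord i) (inord i.+1) x | i <- iota 0 n] :> seq _.
  by rewrite -val_enum_ord -map_comp /= ; exact: eq_map.
suff P k m : is_path (vertex (inord k) x)
    [seq edge (inord i) (inord i.+1) x | i <- iota k m]
    (vertex (inord (k + m)) x) by exact: (P 0 n).
elim: m k => [|m IHm] k /=; first by rewrite addn0.
by rewrite source_edge target_edge addnS -addSn; split.
Qed.

Definition segal (X : symset) n (x : X n) : word X n :=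
  Word (principal_edges_path x).

Definition spiny (X : symset) : Prop :=
  forall n, injective (@segal X n.+1).

Definition partial_groupoid (X : symset) : Prop := spiny X.

(* The partial map d_i on words, as its graph: [inner_face i w w'] says that
   d_i is defined on w with value w'. The letters f and g are those of index
   i and i + 1 (counting from 1), so that 0 < i < size w automatically. If X
   is spiny then s = [f|g] is unique, and w' is determined by i and w. *)
Definition inner_face (X : symset) (i : nat) (w w' : seq (X 1)) : Prop :=
  exists (u : seq (X 1)) (f g : X 1) (v : seq (X 1)) (s : X 2),
    [/\ w = u ++ [:: f, g & v], i = (size u).+1,
        segal s = [:: f; g] :> seq (X 1) & w' = u ++ d1 s :: v].

(* For i = [:: i_1; ...; i_k]: d_{i_1} ... d_{i_k} w is defined and is w'. *)
Fixpoint iter_face (X : symset) (i : seq nat) (w w' : seq (X 1)) : Prop :=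
  if i is k :: i' then exists2 v, iter_face i' w v & inner_face k v w'
  else w = w'.

(* a = d_{i_1} ... d_{i_{n-1}} w for some sequence with 0 < i_k < k + 1;
   the entry i_k is nth 0 i k.-1. *)
Definition total_face (X : symset) n (w : word X n) (a : X 1) : Prop :=
  exists i : seq nat, [/\ size i = n.-1,
    forall k, 0 < k < n -> 0 < nth 0 i k.-1 < k.+1 & iter_face i w [:: a]].

Definition mean (X : symset) n (w : word X n) : Prop :=
  exists a b, [/\ total_face w a, total_face w b & a <> b].

Definition kind (X : symset) n (w : word X n) : Prop := ~ mean w.

Definition sad (X : symset) (a : X 1) : Prop :=
  exists n (w : word X n.+1), mean w /\ total_face w a.

Definition happy (X : symset) (a : X 1) : Prop := ~ sad a.

Record groupoid := Groupoid {
  ob :> Type;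
  hom : ob -> ob -> Type;
  idm : forall x, hom x x;
  comp : forall x y z, hom x y -> hom y z -> hom x z;
  inv : forall x y, hom x y -> hom y x;
  comp_idl : forall x y (f : hom x y), comp (idm x) f = f;
  comp_idr : forall x y (f : hom x y), comp f (idm y) = f;
  comp_assoc : forall x y z t (f : hom x y) (g : hom y z) (h : hom z t),
    comp f (comp g h) = comp (comp f g) h;
  comp_invr : forall x y (f : hom x y), comp f (inv f) = idm x;
  comp_invl : forall x y (f : hom x y), comp (inv f) f = idm y }.

Arguments hom {_} x y.
Arguments idm {_} x.
Arguments comp {_ x y z} _ _.
Arguments inv {_ x y} _.

Record gfunctor (G H : groupoid) := GFunctor {
  fob :> G -> H;
  fhom : forall x y : G, hom x y -> hom (fob x) (fob y);
  fhom_id : forall x : G, fhom (idm x) = idm (fob x);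
  fhom_comp : forall (x y z : G) (f : hom x y) (g : hom y z),
    fhom (comp f g) = comp (fhom f) (fhom g) }.

Arguments fhom {G H} _ {x y} _.

Program Definition comp_gfunctor (G H K : groupoid) (F' : gfunctor H K)
    (F : gfunctor G H) : gfunctor G K :=
  {| fob := fun x => F' (F x); fhom := fun x y f => fhom F' (fhom F f) |}.
Next Obligation. by rewrite !fhom_id. Qed.
Next Obligation. by rewrite !fhom_comp. Qed.

Program Definition codisc (n : nat) : groupoid :=
  {| ob := 'I_n.+1; hom := fun _ _ => unit; idm := fun _ => tt;
     comp := fun _ _ _ _ _ => tt; inv := fun _ _ _ => tt |}.
Next Obligation. by case: f. Qed.
Next Obligation. by case: f. Qed.

Program Definition codisc_map m n (a : 'I_m.+1 -> 'I_n.+1) :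
    gfunctor (codisc m) (codisc n) :=
  {| fob := (a : codisc m -> codisc n); fhom := fun _ _ _ => tt |}.

Lemma gfunctor_eq (G H : groupoid) (ob : G -> H)
    (h h' : forall x y : G, hom x y -> hom (ob x) (ob y)) i c i' c' :
  (forall x y f, h x y f = h' x y f) ->
  @GFunctor G H ob h i c = @GFunctor G H ob h' i' c'.
Proof.
move=> hh'; have E : h = h'.
  by apply: functional_extensionality_dep => x;
     apply: functional_extensionality_dep => y; apply: funext => f.
by case: _ / E i' c' => i' c'; congr GFunctor; exact: Prop_irrelevance.
Qed.

Program Definition nerve (G : groupoid) : symset :=
  {| simplex := fun n => gfunctor (codisc n) G;
     act := fun m n a F => comp_gfunctor F (codisc_map a) |}.
Next Obligation. by case: x => F h i c; apply: gfunctor_eq => ? ? []. Qed.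
Next Obligation. by apply: gfunctor_eq. Qed.

(* The equivalence relation generated by replacing f_i, f_{i+1} with
   d_1 [f_i|f_{i+1}]. Both a replacement and its reverse preserve
   compatibility, endpoints and non-emptiness, so that on compatible words
   this is the relation generated on W^+(X). *)
Definition word_eq (X : symset) : seq (X 1) -> seq (X 1) -> Prop :=
  clos_refl_sym_trans _ (fun w w' => exists i, inner_face i w w').

Local Open Scope quotient_scope.

Section Tau.
Variable X : symset.

Record walk (x y : X 0) := Walk {
  steps :> seq (X 1);
  walk_nonempty : steps <> [::];
  walk_path : is_path x steps y }.

Lemma word_eq_refl (w : seq (X 1)) : word_eq w w.
Proof. exact: rst_refl. Qed.

Lemma word_eq_sym (w w' : seq (X 1)) : word_eq w w' -> word_eq w' w.
Proof. exact: rst_sym. Qed.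

Lemma word_eq_trans (w w' w'' : seq (X 1)) :
  word_eq w w' -> word_eq w' w'' -> word_eq w w''.
Proof. exact: rst_trans. Qed.

Definition walk_eq x y : rel {classic walk x y} :=
  fun w w' => `[< word_eq (steps w) (steps w') >].

Lemma walk_eqP x y : equiv_class_of (@walk_eq x y).
Proof.
split=> [w|w w'|w w' w''].
- by apply/asboolP; exact: word_eq_refl.
- by apply/asboolP/asboolP; exact: word_eq_sym.
- by move=> /asboolP e /asboolP e'; apply/asboolP; exact: word_eq_trans e e'.
Qed.

Canonical walk_equiv x y := EquivRelPack (@walk_eqP x y).

Definition tau_hom (x y : X 0) : Type := {eq_quot (walk_equiv x y)}.

Definition walk_class x y (w : walk x y) : tau_hom x y :=
  (\pi_({eq_quot (walk_equiv x y)}) (w : {classic walk x y}))%qT.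

Definition walk_repr x y (c : tau_hom x y) : walk x y :=
  repr (c : {eq_quot (walk_equiv x y)}).

Lemma walk_reprK x y (c : tau_hom x y) : walk_class (walk_repr c) = c.
Proof. exact: reprK. Qed.

Lemma walk_class_eq x y (w w' : walk x y) :
  walk_class w = walk_class w' <-> word_eq w w'.
Proof.
split=> [/eqmodP/asboolP//|e].
by apply/eqmodP/asboolP.
Qed.

Lemma walk_repr_class x y (w : walk x y) :
  word_eq (walk_repr (walk_class w)) w.
Proof. by apply/walk_class_eq; rewrite walk_reprK. Qed.

Lemma word_eq_cat (u u' v v' : seq (X 1)) :
  word_eq u u' -> word_eq v v' -> word_eq (u ++ v) (u' ++ v').
Proof.
have ctx (p q w w' : seq (X 1)) : word_eq w w' -> word_eq (p ++ w ++ q) (p ++ w' ++ q).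
  elim=> {w w'} [w w' [i [a [f [g [b [s [-> _ e ->]]]]]]]|w|w w' _|w w' w'' _ e _].
  - apply: rst_step; exists (size (p ++ a)).+1.
    by exists (p ++ a), f, g, (b ++ q), s; split=> //; rewrite -!catA.
  - exact: word_eq_refl.
  - exact: word_eq_sym.
  - exact: word_eq_trans e.
move=> /(ctx [::] v)/= e1 /(ctx u' [::]); rewrite !cats0 => e2.
exact: word_eq_trans e1 e2.
Qed.

Lemma word_eq_simplex (s : X 2) :
  word_eq [:: edge ord0 (inord 1) s; edge (inord 1) ord_max s]
          [:: edge ord0 ord_max s].
Proof.
apply: rst_step; exists 1, [::].
exists (edge ord0 (inord 1) s), (edge (inord 1) ord_max s), [::], s.
split=> //; rewrite /segal /= /principal_edges /= enum_ordSl enum_ordSl enum_ord0 /=.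
congr [:: _; _]; congr edge; apply/val_inj; by rewrite /= !inordK.
Qed.

Lemma word_eq_edges n (x : X n) (i j k : 'I_n.+1) :
  word_eq [:: edge i j x; edge j k x] [:: edge i k x].
Proof.
pose a (l : 'I_3) := if l == ord0 then i else if l == ord_max then k else j.
have := word_eq_simplex (act a x); rewrite !edge_act.
by have -> : a (inord 1) = j by rewrite /a -!val_eqE /= inordK.
Qed.

Lemma is_path_cat (x y z : X 0) u v :
  is_path x u y -> is_path y v z -> is_path x (u ++ v) z.
Proof.
by elim: u x => [x ->|f u IHu x [<- up] vp] //=; split=> //; exact: IHu.
Qed.

Definition inv_edge (f : X 1) : X 1 := edge ord_max ord0 f.

Definition inv_seq (w : seq (X 1)) : seq (X 1) := rev (map inv_edge w).

Lemma is_path_inv (x y : X 0) w : is_path x w y -> is_path y (inv_seq w) x.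
Proof.
elim: w x => [x ->|f w IHw x [<- /IHw p]] //.
rewrite /inv_seq map_cons rev_cons -cats1; apply: is_path_cat p _ => /=.
by rewrite /inv_edge source_edge target_edge.
Qed.

Lemma inv_edgeK : involutive inv_edge.
Proof. by move=> f; rewrite /inv_edge {2}/edge edge_act edge01. Qed.

Lemma inv_seqK : involutive inv_seq.
Proof. by move=> w; rewrite /inv_seq map_rev revK (mapK inv_edgeK). Qed.

Lemma word_eq_idl (f : X 1) : word_eq [:: degen (source f); f] [:: f].
Proof.
by have := word_eq_edges f ord0 ord0 ord_max; rewrite edge_diag edge01.
Qed.

Lemma word_eq_idr (f : X 1) : word_eq [:: f; degen (target f)] [:: f].
Proof.
by have := word_eq_edges f ord0 ord_max ord_max; rewrite edge_diag edge01.
Qed.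

Lemma word_eq_invr (f : X 1) : word_eq [:: f; inv_edge f] [:: degen (source f)].
Proof.
by have := word_eq_edges f ord0 ord_max ord0; rewrite edge_diag edge01.
Qed.

Lemma word_eq_inv_seq (x y : X 0) w :
  is_path x w y -> word_eq (degen x :: w ++ inv_seq w) [:: degen x].
Proof.
elim: w x => [|f w IHw] x /=; first by move=> _; exact: word_eq_refl.
move=> [<- p]; rewrite /inv_seq /= rev_cons -cats1 -/(inv_seq w) catA.
have e := word_eq_cat (word_eq_refl [:: f]) (IHw _ p).
apply: word_eq_trans (word_eq_invr f).
have -> : [:: degen (source f), f & (w ++ inv_seq w) ++ [:: inv_edge f]] =
  [:: degen (source f); f] ++ ((w ++ inv_seq w) ++ [:: inv_edge f]) by [].
apply: word_eq_trans (word_eq_cat (word_eq_idl f) (word_eq_refl _)) _.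
apply: word_eq_trans (word_eq_cat (word_eq_sym (word_eq_idr f)) (word_eq_refl _)) _.
have := word_eq_cat e (word_eq_refl [:: inv_edge f]); rewrite /= => e'.
apply: word_eq_trans e' _.
exact: word_eq_cat (word_eq_idr f) (word_eq_refl [:: inv_edge f]).
Qed.

Program Definition walk_id (x : X 0) : walk x x :=
  {| steps := [:: degen x] |}.
Next Obligation.
rewrite /source /target /degen !vertex_act.
by split; rewrite -[RHS]act_id; congr (act _ x); apply: funext => k; rewrite [RHS]ord1.
Qed.

Program Definition walk_cat x y z (u : walk x y) (v : walk y z) : walk x z :=
  {| steps := u ++ v |}.
Next Obligation. by case: u => [[]]. Qed.
Next Obligation. exact: is_path_cat (walk_path u) (walk_path v). Qed.

Program Definition walk_inv x y (u : walk x y) : walk y x :=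
  {| steps := inv_seq u |}.
Next Obligation.
by move=> /(congr1 inv_seq); rewrite inv_seqK; exact: walk_nonempty.
Qed.
Next Obligation. exact: is_path_inv (walk_path u). Qed.

Lemma walk_idl x y (u : walk x y) : word_eq (degen x :: u) u.
Proof.
case: u => -[//|f w] /= _ p; have [<- _] := p.
exact: word_eq_cat (word_eq_idl f) (word_eq_refl w).
Qed.

Lemma walk_invr x y (u : walk x y) : word_eq (u ++ inv_seq u) [:: degen x].
Proof.
apply: word_eq_trans (word_eq_inv_seq (walk_path u)).
by apply: word_eq_sym; exact: (walk_idl (walk_cat u (walk_inv u))).
Qed.

Lemma walk_invl x y (u : walk x y) : word_eq (inv_seq u ++ u) [:: degen y].
Proof. by have := walk_invr (walk_inv u); rewrite /= inv_seqK. Qed.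

Lemma walk_idr x y (u : walk x y) : word_eq (u ++ [:: degen y]) u.
Proof.
have e := word_eq_cat (word_eq_refl u) (word_eq_sym (walk_invl u)).
apply: word_eq_trans e _; rewrite catA.
have e := word_eq_cat (walk_invr u) (word_eq_refl u).
by apply: word_eq_trans e _; exact: walk_idl.
Qed.

Definition tau_comp x y z (c : tau_hom x y) (d : tau_hom y z) : tau_hom x z :=
  walk_class (walk_cat (walk_repr c) (walk_repr d)).

Definition tau_inv x y (c : tau_hom x y) : tau_hom y x :=
  walk_class (walk_inv (walk_repr c)).

Lemma tau_comp_class x y z (u : walk x y) (v : walk y z) :
  tau_comp (walk_class u) (walk_class v) = walk_class (walk_cat u v).
Proof. by apply/walk_class_eq/word_eq_cat; exact: walk_repr_class. Qed.

Program Definition tau : groupoid :=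
  {| ob := X 0; hom := tau_hom; idm := fun x => walk_class (walk_id x);
     comp := tau_comp; inv := tau_inv |}.
Next Obligation.
rewrite -[f in LHS]walk_reprK tau_comp_class -[RHS]walk_reprK.
by apply/walk_class_eq; exact: walk_idl.
Qed.
Next Obligation.
rewrite -[f in LHS]walk_reprK tau_comp_class -[RHS]walk_reprK.
by apply/walk_class_eq; exact: walk_idr.
Qed.
Next Obligation.
rewrite -(walk_reprK f) -(walk_reprK g) -(walk_reprK h) !tau_comp_class.
by apply/walk_class_eq; rewrite /= catA; exact: word_eq_refl.
Qed.
Next Obligation.
rewrite -[f in tau_comp f]walk_reprK tau_comp_class.
by apply/walk_class_eq; exact: walk_invr.
Qed.
Next Obligation.
rewrite -[f in tau_comp _ f]walk_reprK tau_comp_class.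
by apply/walk_class_eq; exact: walk_invl.
Qed.

(* The morphism i -> j of the n-simplex of N(tau X) given by x : X n is the
   class of the one-letter word on the edge of x from i to j. *)
Program Definition edge_walk n (x : X n) (i j : 'I_n.+1) :
    walk (vertex i x) (vertex j x) := {| steps := [:: edge i j x] |}.
Next Obligation. by rewrite source_edge target_edge. Qed.

Program Definition unit_simplex n (x : X n) : gfunctor (codisc n) tau :=
  {| fob := ((fun i => vertex i x) : codisc n -> tau);
     fhom := fun i j _ => walk_class (edge_walk x i j) |}.
Next Obligation.
by apply/walk_class_eq; rewrite /= edge_diag; exact: word_eq_refl.
Qed.
Next Obligation.
rewrite tau_comp_class; apply/walk_class_eq; apply: word_eq_sym.
exact: word_eq_edges.
Qed.

End Tau.

Lemma unit_simplex_act (X : symset) m n (a : 'I_m.+1 -> 'I_n.+1) (x : X n) :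
  unit_simplex (act a x) = act (s := nerve (tau X)) a (unit_simplex x).
Proof.
pose edge_hom k (v : 'I_k.+1 -> X 0) (e : 'I_k.+1 -> 'I_k.+1 -> seq (X 1))
  (N : forall i j, e i j <> [::]) (P : forall i j, is_path (v i) (e i j) (v j))
  (i j : codisc k) (_ : hom i j) : tau_hom (v i) (v j) :=
  walk_class (Walk (N i j) (P i j)).
have E k v e N P v' e' N' P' I C I' C' : v = v' -> e = e' ->
    @GFunctor (codisc k) (tau X) v (@edge_hom k v e N P) I C =
    @GFunctor (codisc k) (tau X) v' (@edge_hom k v' e' N' P') I' C'.
  move=> vv' ee'; subst v' e'; apply: gfunctor_eq => i j f.
  by apply/walk_class_eq; exact: word_eq_refl.
rewrite /unit_simplex /= /comp_gfunctor /=; apply: E.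
- by apply: funext => i; exact: vertex_act.
- by apply: funext => i; apply: funext => j; rewrite edge_act.
Qed.

Definition tau_unit (X : symset) : symmap X (nerve (tau X)) :=
  {| mapn := fun n x => unit_simplex x : nerve (tau X) n;
     map_act := @unit_simplex_act X |}.

(* Main.v *)
Require Import Defs.
From mathcomp Require Import all_boot.
From Stdlib Require Import Relation_Operators Operators_Properties Eqdep.
From mathcomp Require Import boolp.

(** Everything hinges on one intermediate condition, that X separates edges:
    one-letter words [a] and [b] have the same class in the fundamental
    groupoid only if a = b.  Since X is spiny, a simplex is determined by its
    principal edges, so this condition makes the unit injective in every
    degree ([edges_separated_mono]).

    A morphism to the nerve of a groupoid G gives each word a value in G, the
    composite of the images of its letters, and contracting [f|g] to
    d_1 [f|g] does not change it.  If [a] and [b] are equivalent, then a and b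
    have the same image in the nerve, and a = b when the morphism is monic
    ([word_eq_image]).  So if X embeds in some groupoid, then it embeds in its
    fundamental groupoid.  In that case the iterated faces of a word, all being
    equivalent to it, coincide, so no word is mean and no edge is sad; and
    happiness of all edges makes all words kind, because a mean word has sad
    faces.

    It remains to embed X when all words are kind.  For that, one has to turn
    a zigzag of contractions and expansions between [a] and [b] into a single
    word that contracts to both.  The key is that inverses allow an expansion
    to be traded for a cancelling pair.  Let s be a 2-simplex with edges f, g
    and h = d_1 s.  The 2-simplex with vertices 0, 2, 1 of s contracts h, g^-1
    to f; hence h, g^-1, g contracts to f, g, and it also contracts to h by
    cancelling g^-1, g to an identity that h absorbs.  A pair g^-1, g can be
    inserted just as well into any word before its contraction, right after
    the block of letters that contracts to h.  So the insertions can all be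
    done first ([expansion_lift]), and equivalent words have a common word
    contracting to both ([word_eq_common]).  For one-letter words [a] and [b]
    such a word is kind only if a = b. *)

Set Implicit Arguments.
Unset Strict Implicit.
Unset Printing Implicit Defensive.

(** * Monomorphisms are the levelwise injective maps *)

Lemma symmap_ext (X Y : symset) (g h : symmap X Y) :
  (forall n (x : X n), g n x = h n x) -> g = h.
Proof.
case: g h => [g gP] [h hP] /= gh; have E : g = h.
  by apply: functional_extensionality_dep => n; apply: funext => x; exact: gh.
by case: _ / E hP => hP; congr SymMap; exact: Prop_irrelevance.
Qed.

Lemma injective_mono (X Y : symset) (f : symmap X Y) :
  (forall n, injective (f n)) -> is_mono f.
Proof.
move=> f_inj Z g h fgh; apply: symmap_ext => n z; apply: f_inj.
exact: (congr1 (fun k : symmap Z Y => k n z) fgh).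
Qed.

Definition representable (n : nat) : symset :=
  {| simplex := fun m => 'I_m.+1 -> 'I_n.+1;
     act := fun _ _ a x => x \o a;
     act_id := fun _ _ => erefl;
     act_comp := fun _ _ _ _ _ _ => erefl |}.

Definition yoneda (X : symset) n (x : X n) : symmap (representable n) X :=
  {| mapn := fun m (a : representable n m) => act a x;
     map_act := fun _ _ b a => act_comp b a x |}.

(** A simplex is a map out of a representable, so a monomorphism tells
    simplices apart. *)
Lemma mono_injective (X Y : symset) (f : symmap X Y) :
  is_mono f -> forall n, injective (f n).
Proof.
move=> f_mono n x y fxy.
suff E : yoneda x = yoneda y.
  have := congr1 (fun k : symmap (representable n) X => k n id) E.
  by rewrite /= !act_id.
by apply: f_mono; apply: symmap_ext => m a /=; rewrite !map_act fxy.
Qed.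

(** * Contractions *)

Section Contractions.
Variable X : symset.
Implicit Types (u v w : seq (X 1)) (a f g : X 1).

Definition contraction w w' : Prop := exists i, inner_face i w w'.

Definition contracts : seq (X 1) -> seq (X 1) -> Prop :=
  clos_refl_trans _ contraction.

Lemma segal2 (s : X 2) : segal s =
  [:: edge ord0 (inord 1) s; edge (inord 1) ord_max s] :> seq (X 1).
Proof.
rewrite /segal /= /principal_edges /= enum_ordSl enum_ordSl enum_ord0 /=.
by congr [:: _; _]; congr edge; apply/val_inj; rewrite /= !inordK.
Qed.

Lemma contractionP w w' : contraction w w' <-> exists u v (s : X 2),
  w = u ++ [:: edge ord0 (inord 1) s, edge (inord 1) ord_max s & v] /\
  w' = u ++ edge ord0 ord_max s :: v.
Proof.
split=> [[_ [u [f [g [v [s [-> _ sE ->]]]]]]]|[u [v [s [-> ->]]]]].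
  by exists u, v, s; move: sE; rewrite segal2 => -[<- <-].
exists (size u).+1, u, (edge ord0 (inord 1) s), (edge (inord 1) ord_max s).
by exists v, s; split=> //; exact: segal2.
Qed.

Lemma contraction_ctx u v w w' :
  contraction w w' -> contraction (u ++ w ++ v) (u ++ w' ++ v).
Proof.
move=> /contractionP[p [q [s [-> ->]]]]; apply/contractionP.
by exists (u ++ p), (q ++ v), s; rewrite -!catA.
Qed.

Lemma contracts_cat u u' v v' :
  contracts u u' -> contracts v v' -> contracts (u ++ v) (u' ++ v').
Proof.
have ctx p q w w' : contracts w w' -> contracts (p ++ w ++ q) (p ++ w' ++ q).
  elim=> {w w'} [w w' ww'|w|w w' w'' _ e _]; last exact: rt_trans.
    by apply: rt_step; exact: contraction_ctx.
  exact: rt_refl.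
move=> /(ctx [::] v)/= e1 /(ctx u' [::]); rewrite !cats0 => e2.
exact: rt_trans e1 e2.
Qed.

Lemma contracts_word_eq w w' : contracts w w' -> word_eq w w'.
Proof. exact: clos_rt_clos_rst. Qed.

(** The three vertices may come in any order and may coincide: a symmetric
    set has a 2-simplex on any of them.  This is where identities and
    inverses come from. *)
Lemma contraction_edges n (x : X n) (i j k : 'I_n.+1) :
  contraction [:: edge i j x; edge j k x] [:: edge i k x].
Proof.
pose c (l : 'I_3) := if l == ord0 then i else if l == ord_max then k else j.
apply/contractionP; exists [::], [::], (act c x); rewrite !edge_act.
by have -> : c (inord 1) = j by rewrite /c -!val_eqE /= inordK.
Qed.

Lemma contraction_idr f : contraction [:: f; degen (target f)] [:: f].
Proof.
by have := contraction_edges f ord0 ord_max ord_max; rewrite edge_diag edge01.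
Qed.

Lemma contraction_invl g : contraction [:: inv_edge g; g] [:: degen (target g)].
Proof.
by have := contraction_edges g ord_max ord0 ord_max; rewrite edge_diag edge01.
Qed.

(** The word must be nonempty: the pair contracts to an identity, and only a
    neighbouring letter can absorb that.  The hypothesis on [last] says that
    w ends where g ends. *)
Lemma contracts_insert w g : w <> [::] ->
  last (target g) (map (@target X) w) = target g ->
  contracts (w ++ [:: inv_edge g; g]) w.
Proof.
case/lastP: w => // w f _; rewrite map_rcons last_rcons => fg.
have step1 := contracts_cat (rt_refl _ _ (rcons w f))
  (rt_step _ _ _ _ (contraction_invl g)).
apply: rt_trans step1 _; rewrite -fg -cats1 -catA.
exact: contracts_cat (rt_refl _ _ w) (rt_step _ _ _ _ (contraction_idr f)).
Qed.

Lemma contracts_last y w w' : contracts w w' ->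
  last y (map (@target X) w) = last y (map (@target X) w').
Proof.
elim=> {w w'} [w w' /contractionP[u [v [s [-> ->]]]]|//|w w' w'' _ -> _ //].
by rewrite !map_cat /= !last_cat /= !target_edge.
Qed.

Lemma contracts_nil w' w : contracts w w' -> w' <> [::] -> w <> [::].
Proof.
elim=> {w w'}
  [w w' /contractionP[u [v [s [-> _]]]] _|//|w w' w'' _ e _ e' /e'/e //].
by case: u.
Qed.

(** Compatibility goes backwards along a contraction because the letters f
    and g that were replaced are edges of a 2-simplex, hence composable. *)
Lemma contracts_path x y w w' :
  contracts w w' -> is_path x w' y -> is_path x w y.
Proof.
elim=> {w w'}
  [w w' /contractionP[u [v [s [-> ->]]]]|//|w w' w'' _ e _ e' /e'/e //].
elim: u x => [|f u IHu] x /=; last by move=> [? /IHu].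
by rewrite !source_edge !target_edge => -[].
Qed.

Lemma cat_eq_split (T : Type) (u v p q : seq T) (x : T) :
  u ++ v = p ++ x :: q ->
  (exists r, u = p ++ x :: r /\ q = r ++ v) \/
  (exists r, v = r ++ x :: q /\ p = u ++ r).
Proof.
elim: u p => [|y u IHu] [|z p] /=.
- by move=> ->; right; exists [::].
- by move=> ->; right; exists (z :: p).
- by move=> [-> <-]; left; exists u.
- move=> [-> /IHu[] [r [-> ->]]]; first by left; exists r.
  by right; exists r.
Qed.

(** Each letter of a contracted word comes from a block of consecutive letters
    of the original one, and the blocks are contracted independently. *)
Lemma contracts_split w u v : contracts w (u ++ v) ->
  exists u' v', [/\ w = u' ++ v', contracts u' u & contracts v' v].
Proof.
move: {2}(u ++ v) (erefl (u ++ v)) => z uvz wz; rewrite uvz in wz.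
elim: wz u v uvz => {w z}
  [w z /contractionP[p [q [s [-> ->]]]]|w|w w' z _ IH1 _ IH2] u v.
- move=> uv; case: (cat_eq_split uv) => -[r [-> ->]].
  + exists (p ++ [:: edge ord0 (inord 1) s, edge (inord 1) ord_max s & r]), v.
    split; [by rewrite -catA | | exact: rt_refl].
    apply: rt_step; apply/contractionP.
    by exists p, r, s.
  + exists u, (r ++ [:: edge ord0 (inord 1) s, edge (inord 1) ord_max s & q]).
    split; [by rewrite -catA | exact: rt_refl |].
    apply: rt_step; apply/contractionP.
    by exists r, q, s.
- by move=> <-; exists u, v; split=> //; exact: rt_refl.
- move=> /IH2[u1 [v1 [e u1u v1v]]].
  have [u2 [v2 [-> u2u1 v2v1]]] := IH1 _ _ (esym e).
  by exists u2, v2; split=> //; [exact: rt_trans u1u | exact: rt_trans v1v].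
Qed.

(** Contractions are confluent in the backward direction.  The common ancestor
    is w with a cancelling pair inserted right after the block that contracts
    to the letter expanded in v'. *)
Lemma expansion_lift w v v' : contracts w v -> contraction v' v ->
  exists w', contracts w' w /\ contracts w' v'.
Proof.
move=> wv /contractionP[p [q [s [-> vE]]]]; move: wv; rewrite {}vE.
set f := edge ord0 (inord 1) s; set g := edge (inord 1) ord_max s.
set h := edge ord0 ord_max s => wv.
have [p' [r [-> p'p]]] := contracts_split wv.
rewrite -cat1s => /contracts_split[h' [q' [-> h'h q'q]]].
(* h' contracts to h, and then h, g^-1 contracts to f. *)
exists (p' ++ (h' ++ [:: inv_edge g; g]) ++ q'); split.
  apply: contracts_cat (rt_refl _ _ _) (contracts_cat _ (rt_refl _ _ _)).
  apply: contracts_insert; first exact: contracts_nil h'h _.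
  by rewrite (contracts_last _ h'h) /= /h /g !target_edge.
apply: contracts_cat p'p _.
rewrite -[[:: f, g & q]]/([:: f; g] ++ q); apply: contracts_cat q'q.
apply: rt_trans (contracts_cat h'h (rt_refl _ _ _)) _.
apply: (@contracts_cat [:: h; inv_edge g] [:: f] _ _ _ (rt_refl _ _ [:: g])).
apply: rt_step.
have -> : inv_edge g = edge ord_max (inord 1) s.
  by rewrite /inv_edge /g {2}/edge edge_act.
exact: contraction_edges.
Qed.

(** By induction along a zigzag from w: a contraction extends the reduction of
    the common word, an expansion is absorbed by enlarging it. *)
Lemma word_eq_common w w' : word_eq w w' ->
  exists z, contracts z w /\ contracts z w'.
Proof.
move=> /clos_rst_rstn1_iff; elim=> [|v v' [vv'|v'v] _ [z [zw zv]]].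
- by exists w; split; exact: rt_refl.
- by exists z; split=> //; apply: rt_trans zv _; exact: rt_step.
- have [z' [z'z z'v']] := expansion_lift zv v'v.
  by exists z'; split=> //; exact: rt_trans z'z zw.
Qed.

(** Any sequence of contractions gives admissible indices: a face d_i is
    defined on a word of length k + 1 only for 0 < i < k + 1. *)
Lemma contracts_iter_face w a : contracts w [:: a] -> exists i,
  [/\ size i = (size w).-1,
      forall k, 0 < k < size w -> 0 < nth 0 i k.-1 < k.+1
    & iter_face i w [:: a]].
Proof.
(* For an arbitrary end word z, the last index applied acts on a word of
   length size z + 1, so the list starts with i_k for k = size z. *)
suff H z : contracts w z -> exists i, [/\ size w = size i + size z,
    forall k, size z <= k < size w -> 0 < nth 0 i (k - size z) < k.+1
    & iter_face i w z].
  move=> /H[i [wi iP wa]]; exists i; split=> [|k kw|//].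
    by rewrite wi addn1.
  by have := iP k kw; rewrite subn1.
move=> /clos_rt_rtn1_iff; elim=> [|v v' [j vv'] _ [i [wi iP wv]]].
  exists [::]; split=> // k /andP[wk kw].
  by move: (leq_ltn_trans wk kw); rewrite ltnn.
have [vE j0 jv] : [/\ size v = (size v').+1, 0 < j & j < size v].
  case: vv' => [u [f [g [q [s [-> -> _ ->]]]]]].
  by rewrite !size_cat /= !addnS; split=> //; rewrite !ltnS leq_addr.
exists (j :: i); split=> [|k /andP[v'k kw]|]; last by exists v.
  by rewrite wi vE addSnnS.
move: v'k; rewrite leq_eqVlt => /orP[/eqP<-|v'k].
  by rewrite subnn /= j0 -vE.
by rewrite -(subnSK v'k) /= -vE iP // vE v'k.
Qed.

Lemma iter_face_contracts i w w' : iter_face i w w' -> contracts w w'.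
Proof.
elim: i w' => [|k i IHi] w' /=; first by move=> ->; exact: rt_refl.
by move=> [v /IHi wv vw']; apply: rt_trans wv _; apply: rt_step; exists k.
Qed.

Lemma total_face_word_eq n (w : word X n) a :
  total_face w a -> word_eq w [:: a].
Proof. by move=> [i [_ _ /iter_face_contracts/contracts_word_eq]]. Qed.

Lemma contracts_total_face n (w : word X n) a :
  contracts w [:: a] -> total_face w a.
Proof.
by move=> /contracts_iter_face[i]; rewrite size_tuple => iP; exists i.
Qed.

End Contractions.

(** For X spiny this is equivalent to the unit being a monomorphism, but it
    makes no mention of quotients. *)
Definition edges_separated (X : symset) : Prop :=
  forall a b : X 1, word_eq [:: a] [:: b] -> a = b.

(** A common ancestor of [a] and [b] is nonempty and compatible, so it is a
    word; it is mean as soon as a and b differ. *)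
Lemma kind_edges_separated (X : symset) :
  (forall n (w : word X n.+1), kind w) -> edges_separated X.
Proof.
move=> kindX a b /word_eq_common[z [za zb]].
have zP : exists x y, is_path x z y.
  by exists (source a), (target a); exact: contracts_path za _.
have z0 : z <> [::] by exact: contracts_nil za _.
case: z z0 za zb zP => // f z _ za zb zP.
apply: contrapT => ab; apply: (kindX _ (@Word X _ (in_tuple (f :: z)) zP)).
by exists a, b; split=> //; exact: contracts_total_face.
Qed.

(** * Injectivity of the unit *)

(** Comparing representatives of the classes, as plain sequences, avoids
    transporting morphisms along the equality of their end points. *)
Lemma unit_simplex_word_eq (X : symset) n (x y : X n) (i j : 'I_n.+1) :
  unit_simplex x = unit_simplex y -> word_eq [:: edge i j x] [:: edge i j y].
Proof.
pose letters_of (F : gfunctor (codisc n) (tau X)) : seq (X 1) :=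
  walk_repr (@fhom _ _ F i j tt).
move=> /(congr1 letters_of) E.
apply: word_eq_trans (word_eq_sym (walk_repr_class (edge_walk x i j))) _.
by have := walk_repr_class (edge_walk y i j); rewrite -[steps _]E.
Qed.

Lemma edges_separated_mono (X : symset) :
  spiny X -> edges_separated X -> is_mono (tau_unit X).
Proof.
move=> spX sepX; apply: injective_mono => -[|n] x y xy.
  (* Spininess says nothing in degree 0, where the unit is the identity on
     objects. *)
  have vertex0 (z : X 0) : vertex ord0 z = z.
    by rewrite -[RHS]act_id; congr act; apply: funext => k; rewrite [RHS]ord1.
  rewrite -[LHS]vertex0 -[RHS]vertex0.
  exact: (congr1 (fun F : gfunctor (codisc 0) (tau X) => F ord0) xy).
apply: spX; rewrite /segal.
have E : principal_edges x = principal_edges y.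
  apply: eq_from_tnth => i; rewrite !tnth_mktuple.
  by apply: sepX; exact: unit_simplex_word_eq.
move: (principal_edges_path x) (principal_edges_path y); rewrite E => p q.
by congr Word; exact: Prop_irrelevance.
Qed.

(** * Values of words in a groupoid *)

Section Arrows.
Variable G : groupoid.

Definition arrow n (S : nerve G n) (i j : 'I_n.+1) :
  hom (fob S i) (fob S j) := @fhom _ _ S i j tt.

(** Packing the source with the morphism lets morphisms whose sources are
    equal only propositionally be compared. *)
Definition arrow_from (y x : G) (h : hom x y) : {x : G & hom x y} :=
  existT _ x h.

Lemma arrow_from_inj y x (h k : hom x y) : arrow_from h = arrow_from k -> h = k.
Proof. exact: inj_pair2. Qed.

Lemma arrow_comp n (S : nerve G n) i j k :
  Defs.comp (arrow S i j) (arrow S j k) = arrow S i k.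
Proof. by rewrite /arrow -(fhom_comp S). Qed.

Lemma arrow_id n (S : nerve G n) i : arrow S i i = idm (fob S i).
Proof. exact: (fhom_id S). Qed.

Lemma arrow_inv n (S : nerve G n) i j : arrow S j i = Defs.inv (arrow S i j).
Proof.
rewrite -[RHS]comp_idr -(arrow_id S i) -(arrow_comp S i j i) comp_assoc.
by rewrite comp_invl comp_idl.
Qed.

(** A 1-simplex of the nerve is determined by its principal edge, the other
    arrows being identities and an inverse.  The equality of principal edges
    is given in two steps because k, which is an identity only up to the
    equality of its end points, is what [value] yields on one letter. *)
Lemma nerve1_eq (S T : nerve G 1)
    (k : hom (fob T ord_max) (fob S ord_max)) :
  arrow_from k = arrow_from (idm (fob S ord_max)) ->
  arrow_from (arrow S ord0 ord_max) =
  arrow_from (Defs.comp (arrow T ord0 ord_max) k) -> S = T.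
Proof.
have ord2 (i : 'I_2) : i = ord0 \/ i = ord_max.
  by case: i => -[|[|//]] i; [left|right]; exact/val_inj.
move: (@arrow_inv 1 T) (@arrow_id 1 T) k.
move: (@arrow_inv 1 S) (@arrow_id 1 S).
case: S T => p h hi hc [q h' hi' hc'].
rewrite /arrow /= => Si Sd Ti Td k kE hE.
have E0 : p ord0 = q ord0 := congr1 (@projT1 _ _) hE.
have E1 : q ord_max = p ord_max := congr1 (@projT1 _ _) kE.
have pq : p = q by apply: funext => i; case: (ord2 i) => ->.
subst q.
move/arrow_from_inj: kE hE => -> /arrow_from_inj; rewrite comp_idr => hE.
apply: gfunctor_eq => i j []; case: (ord2 i) => ->; case: (ord2 j) => -> //.
- by rewrite Sd Td.
- by rewrite Si Ti hE.
- by rewrite Sd Td.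
Qed.

End Arrows.

Section Values.
Variables (X : symset) (G : groupoid) (F : symmap X (nerve G)).

(** The relation that the composite of the images of the letters of w,
    followed by the identity of y, is t.  A relation is used because
    consecutive letters compose only up to an equality of objects, and need
    not compose at all when w is not compatible. *)
Fixpoint value (y : G) (w : seq (X 1)) (t : {x : G & hom x y}) : Prop :=
  if w is f :: w' then exists k : hom (fob (F 1 f) ord_max) y,
    value w' (arrow_from k) /\
    t = arrow_from (Defs.comp (arrow (F 1 f) ord0 ord_max) k)
  else t = arrow_from (idm y).

Lemma value_edge y n (x : X n) i j w t :
  value (y := y) (edge i j x :: w) t <->
  exists k : hom (fob (F n x) j) y, value w (arrow_from k) /\
    t = arrow_from (Defs.comp (arrow (F n x) i j) k).
Proof. by rewrite /= /edge map_act. Qed.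

(** Functoriality of the image of the 2-simplex: its edges f, g have in G the
    composite given by the image of its face d_1. *)
Lemma value_contraction y w w' t :
  contraction w w' -> value (y := y) w t <-> value w' t.
Proof.
move=> /contractionP[u [v [s [-> ->]]]].
elim: u t => [|f u IHu] t; last first.
  by split=> -[k [kv ->]]; exists k; split=> //; apply/IHu.
rewrite !cat0s; split.
  move=> /value_edge[k [/value_edge[l [lv /arrow_from_inj ->]] ->]].
  by apply/value_edge; exists l; rewrite comp_assoc arrow_comp.
move=> /value_edge[l [lv ->]]; apply/value_edge.
exists (Defs.comp (arrow (F 2 s) (inord 1) ord_max) l); split.
  by apply/value_edge; exists l.
by rewrite comp_assoc arrow_comp.
Qed.

Lemma value_word_eq y w w' t :
  word_eq w w' -> value (y := y) w t <-> value w' t.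
Proof.
elim=> {w w'} [w w'|w|w w' _ ->|w w' w'' _ -> _ ->] //.
exact: value_contraction.
Qed.

Lemma word_eq_image a b : word_eq [:: a] [:: b] -> F 1 a = F 1 b.
Proof.
move=> ab; pose t := arrow_from (arrow (F 1 a) ord0 ord_max).
have : value [:: a] t.
  by exists (idm _); rewrite comp_idr.
move=> /(value_word_eq _ ab)[k [kE tE]].
exact: nerve1_eq kE tE.
Qed.

End Values.

Theorem corollary3 (X : symset) (pgX : partial_groupoid X) :
  [<-> exists (G : groupoid) (f : symmap X (nerve G)), is_mono f;
       is_mono (tau_unit X);
       forall f : X 1, happy f;
       forall (n : nat) (w : word X n.+1), kind w].
Proof.
have separated_of G (f : symmap X (nerve G)) : is_mono f -> edges_separated X.
  by move=> f_mono a b /(word_eq_image f)/(mono_injective f_mono).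
tfae.
- by move=> [G [f /separated_of]]; exact: edges_separated_mono.
- move=> /separated_of sepX a [n [w [[b [c [wb wc bc]]] _]]]; apply: bc.
  apply: sepX; apply: word_eq_trans (total_face_word_eq wc).
  exact: word_eq_sym (total_face_word_eq wb).
- move=> happyX n w w_mean; have [a [_ [wa _ _]]] := w_mean.
  by apply: (happyX a); exists n, w.
- move=> /kind_edges_separated/(edges_separated_mono pgX) unit_mono.
  by exists (tau X), (tau_unit X).
Qed.
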